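(* Define $A:=\mathbf{e}^{T}\Sigma^{-1}\mathbf{e}$, $B:=\mu^{T}\Sigma^{-1}\mathbf{e}$, $C:=\mu^{T}\Sigma^{-1}\mu$. Suppose $\kappa(\epsilon)>0$. The problem $$\max_{\mathbf{x}\in\mathbb{R}^n:\ \mathbf{x}^{T}\mathbf{e}=1}\ \mathbf{x}^{T}\mu\quad\text{s.t.}\quad\kappa(\epsilon)\sqrt{\mathbf{x}^{T}\Sigma\mathbf{x}}-\mathbf{x}^{T}\mu\le\delta\qquad(\mathrm{CCO})$$ has an optimal solution when $(\epsilon,\delta)$ satisfies $$C-\frac{B^{2}}{A}<\kappa(\epsilon)^{2}<\delta^{2}A+2\delta B+C\quad\text{and}\quad B+\delta A>0,$$ and the optimal solution $\tilde{\mathbf{x}}^*$ and optimal value $\tilde v^*$ are $$\tilde{\mathbf{x}}^{*}=\frac{\Sigma^{-1}[(1+\tilde\lambda)\mu-\tilde\theta\mathbf{e}]}{(1+\tilde\lambda)B-\tilde\theta A},\qquad\tilde v^{*}=\tilde\lambda\delta+\tilde\theta,$$ where $$\tilde\lambda=\frac{\sqrt{AC-B^2}}{A\kappa(\epsilon)^{2}-AC+B^{2}}\left(\frac{\kappa(\epsilon)(B+A\delta)}{\sqrt{A\delta^{2}+2B\delta+C-\kappa(\epsilon)^{2}}}+\sqrt{AC-B^2}\right),\qquad\tilde\theta=\frac{(C+\delta B)(\tilde\lambda+1)-\tilde\lambda\kappa(\epsilon)^{2}}{B+\delta A}.$$ Furthermore, $\tilde v^*\ge v^*$, where $v^*$ is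 the optimal value of the mean-deviation (DRO) problem $$\max_{\mathbf{x}\in\mathbb{R}^n:\ \mathbf{x}^{T}\mathbf{e}=1}\left\{\mathbf{x}^{T}\mu-\sqrt{\frac{2\rho\,\mathbf{x}^{T}\Sigma\mathbf{x}}{\phi^{(2)}(1)}}\right\},$$ for any $\phi$ with $\phi^{(2)}(1)>0$ and any $\rho>\frac{\phi^{(2)}(1)}{2}\left(C-\frac{B^2}{A}\right)$ (so that this problem has an optimal solution).
   Context: $\mathbf{e}\in\mathbb{R}^n$ is the all-ones vector; $\mu\in\mathbb{R}^n$ and $\Sigma\in\mathbb{R}^{n\times n}$ are the mean and covariance matrix of the asset returns $\mathbf{r}$ under the nominal distribution $\mathbb{P}_0$, with $\Sigma$ invertible (hence symmetric positive definite). $\delta>0$ is a loss threshold, $\epsilon>0$ a loss probability, and $\kappa(\epsilon)$ is a real number depending on $\epsilon$ (such that $\kappa(\epsilon)\sqrt{\mathbf{x}^T\Sigma\mathbf{x}}-\mathbf{x}^T\mu$ equals or approximates the Value-at-Risk of the portfolio $\mathbf{x}$ at level $\epsilon$; e.g. $\kappa(\epsilon)=-\Phi^{-1}(\epsilon)$, with $\Phi$ the standard normal cumulative distribution function, when $\mathbb{P}_0$ is normal). $\rho>0$ is the ambiguity radius and $\phi$ the function defining the $\phi$-divergence, $\phi^{(2)}(1)$ its second derivative at $1$.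
   Formalization: The formula for the optimal solution is claimed only when μ is not a multiple of e; otherwise AC = B² and the formula reads 0/0. Existence of an optimal solution, the optimal value and the comparison with the DRO value are claimed in all cases. *)

(* Defs.v *)
From HB Require Import structures.
From mathcomp Require Import all_boot all_order all_algebra.
From mathcomp Require Import all_classical all_reals all_analysis.
Export numFieldNormedType.Exports.

Set Implicit Arguments.
Unset Strict Implicit.
Unset Printing Implicit Defensive.

Import Order.TTheory GRing.Theory Num.Theory.
Local Open Scope classical_set_scope.
Local Open Scope ring_scope.

Definition dotmul {R : realType} {n : nat} (u v : 'cV[R]_n) : R :=
  (u^T *m v) 0 0.

Definition ones {R : realType} {n : nat} : 'cV[R]_n := const_mx 1.

(* For a square-integrable random vector r, every expectation and covariance
   below is finite, so that [fine] loses nothing. *)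
Definition mean_vector {d} {T : measurableType d} {R : realType}
    (P : probability T R) (n : nat) (r : 'I_n -> {RV P >-> R}) : 'cV[R]_n :=
  \col_i fine ('E_P[r i]).

Definition covariance_matrix {d} {T : measurableType d} {R : realType}
    (P : probability T R) (n : nat) (r : 'I_n -> {RV P >-> R}) : 'M[R]_n :=
  \matrix_(i, j) fine (covariance P (r i) (r j)).

Definition optimal {R : realType} {T : Type} (X : set T) (f : T -> R) (x : T)
  : Prop := X x /\ forall y, X y -> f y <= f x.

(* [sup] is only meaningful on nonempty bounded sets; whenever an optimal
   solution exists, this is the value of f at any optimal solution. *)
Definition optimal_value {R : realType} {T : Type} (X : set T) (f : T -> R)
  : R := sup (f @` X).

Definition budget {R : realType} {n : nat} : set 'cV[R]_n :=
  [set x | dotmul x ones = 1].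

Definition stdev {R : realType} {n : nat} (Sigma : 'M[R]_n) (x : 'cV[R]_n)
  : R := Num.sqrt (dotmul x (Sigma *m x)).

Definition cco_feasible {R : realType} {n : nat} (mu : 'cV[R]_n)
    (Sigma : 'M[R]_n) (k delta : R) : set 'cV[R]_n :=
  [set x | budget x /\ k * stdev Sigma x - dotmul x mu <= delta].

Definition dro_objective {R : realType} {n : nat} (mu : 'cV[R]_n)
    (Sigma : 'M[R]_n) (rho phi2 : R) (x : 'cV[R]_n) : R :=
  dotmul x mu - Num.sqrt (2 * rho * dotmul x (Sigma *m x) / phi2).

(* [f^`(2) x] is a total expression in the library; this makes it a genuine
   second derivative. *)
Definition twice_derivable {R : realType} (f : R -> R) (x : R) : Prop :=
  (\forall y \near x, derivable f y 1) /\ derivable (f^`())%classic x 1.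

(* Main.v *)
(* Write V = C - B^2/A. The portfolios
     x_tau = Sigma^-1 (e/A + tau (mu - (B/A) e))
   satisfy the budget constraint, have mean B/A + tau V and variance
   1/A + tau^2 V, and every budget portfolio x satisfies
   x^T Sigma x_tau = 1/A + tau (x^T mu - B/A).  By Cauchy-Schwarz the left-hand
   side is at most the product of the standard deviations of x and x_tau, which
   gives a supporting line of the mean-deviation frontier at x_tau.
   Both problems are solved by reading off an optimality certificate from this
   line: for (CCO), tau is the value at which the risk constraint is tight; for
   (DRO), with k' = sqrt (2 rho / phi''(1)), it is tau = 1/h with
   h = sqrt (A (k'^2 - V)), and the optimal value is B/A - h/A.  The (CCO) value
   B/A + tau V is at least B/A, hence exceeds the (DRO) value.
   If V = 0 then mu is a multiple of e, so that all budget portfolios have mean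
   B/A. *)
Require Import Defs.
From HB Require Import structures.
From mathcomp Require Import all_boot all_order all_algebra.
From mathcomp Require Import all_classical all_reals all_analysis.
From mathcomp Require Import ring lra.
Set Implicit Arguments.
Unset Strict Implicit.
Unset Printing Implicit Defensive.

Import Order.TTheory GRing.Theory Num.Theory.
Local Open Scope classical_set_scope.
Local Open Scope ring_scope.

(** * Covariance matrices as variance forms *)

Lemma covariance_sum_l d (T : measurableType d) (R : realType)
    (P : probability T R) (I : Type) (s : seq I) (a : I -> R)
    (X : I -> T -> R) (Y : T -> R) :
  (forall i, X i \in Lfun P 2%:E) -> Y \in Lfun P 2%:E ->
  fine (covariance P (\sum_(i <- s) a i \o* X i) Y) =
  \sum_(i <- s) a i * fine (covariance P (X i) Y).
Proof.
move=> X2 Y2.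
have Pfin : P setT \is a fin_num := fin_num_measure P _ measurableT.
have aX2 i : a i \o* X i \in Lfun P 2%:E by rewrite Lfun_scale ?ler1n.
have cov_fin (U V : T -> R) : U \in Lfun P 2%:E -> V \in Lfun P 2%:E ->
    covariance P U V \is a fin_num.
  move=> U2 V2.
  by rewrite covariance_fin_num ?Lfun2_mul_Lfun1 ?(Lfun_subset12 Pfin).
elim: s => [|i s IHs].
  by rewrite !big_nil; rewrite (covariance_cst_l P 0).
have s2 : \sum_(j <- s) a j \o* X j \in Lfun P 2%:E.
  by apply: rpred_sum => *; rewrite ?lee1n ?aX2.
rewrite !big_cons -IHs [X in covariance P X](_ : _ =
  ((a i \o* X i) \+ \sum_(j <- s) a j \o* X j)%R) // covarianceDl//.
rewrite fineD ?cov_fin// covarianceZl ?Lfun2_mul_Lfun1 ?(Lfun_subset12 Pfin)//.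
by rewrite fineM ?cov_fin.
Qed.

(** Bilinearity of covariance, applied in each argument in turn. Since a variance is nonnegative,
    this makes the covariance matrix positive semidefinite. *)
Lemma covariance_matrix_form d (T : measurableType d) (R : realType)
    (P : probability T R) (n : nat) (r : 'I_n -> {RV P >-> R})
    (x : 'cV[R]_n) :
  (forall i, (r i : T -> R) \in Lfun P 2%:E) ->
  dotmul x (covariance_matrix r *m x) =
  fine (variance P (\sum_i x i 0 \o* (r i : T -> R))).
Proof.
move=> r2.
have S2 : \sum_i x i 0 \o* (r i : T -> R) \in Lfun P 2%:E.
  by apply: rpred_sum => *; rewrite ?lee1n ?Lfun_scale ?ler1n.
rewrite /variance covariance_sum_l// /dotmul mxE; apply: eq_bigr => i _.
rewrite !mxE covarianceC covariance_sum_l//; congr (_ * _).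
by apply: eq_bigr => j _; rewrite !mxE mulrC covarianceC.
Qed.

Lemma tr_covariance_matrix d (T : measurableType d) (R : realType)
    (P : probability T R) (n : nat) (r : 'I_n -> {RV P >-> R}) :
  (covariance_matrix r)^T = covariance_matrix r.
Proof. by apply/matrixP => i j; rewrite !mxE covarianceC. Qed.

(** * Scalar identities behind the closed form *)

(* [D] and [q] are the two square roots of the closed form; [tau] makes the risk
   constraint tight. *)
Lemma frontier_scalars (F : fieldType) (A B C delta k q D : F) :
  let E := B + delta * A in
  D ^+ 2 = A * C - B ^+ 2 ->
  q ^+ 2 = A * delta ^+ 2 + 2 * B * delta + C - k ^+ 2 ->
  A != 0 -> E != 0 -> q != 0 -> D != 0 ->
  A * k ^+ 2 - D ^+ 2 != 0 ->
  let lambda := D / (A * k ^+ 2 - A * C + B ^+ 2)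
    * (k * (B + A * delta) / q + D) in
  let theta := ((C + delta * B) * (lambda + 1) - lambda * k ^+ 2) / E in
  let tau := (E + A * k * q / D) / (A * k ^+ 2 - D ^+ 2) in
  let V := C - B ^+ 2 / A in
  [/\ (1 + lambda) * B - theta * A = k * D / q,
      1 + lambda = tau * (k * D / q),
      lambda * delta + theta = B / A + tau * V,
      k ^+ 2 * (A^-1 + tau ^+ 2 * V) = (B / A + tau * V + delta) ^+ 2 &
      k ^+ 2 * tau - (B / A + tau * V + delta) = k * q / D].
Proof.
move=> E Dq qq A0 E0 q0 D0 K0 lambda theta tau V.
(* This relation eliminates [delta]: after [C] is expressed through [D], each identity below reduces
   to it by clearing denominators. *)
have EE : E ^+ 2 = A * (k ^+ 2 + q ^+ 2) - D ^+ 2 by rewrite /E Dq qq; ring.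
have lamE : lambda = D / (A * k ^+ 2 - D ^+ 2) * (k * E / q + D).
  by rewrite /lambda /E Dq opprB addrA (mulrC A delta) addrAC.
have CE : C = (D ^+ 2 + B ^+ 2) / A by rewrite Dq; field.
have VE : V = D ^+ 2 / A by rewrite /V CE; field.
have denE : (1 + lambda) * B - theta * A = k * D / q.
  have -> : (1 + lambda) * B - theta * A =
    (lambda * (A * k ^+ 2 - D ^+ 2) - D ^+ 2) / E.
    by rewrite Dq /theta -/E; move: (E0); rewrite /E => ?; field.
  by rewrite lamE; field; rewrite q0 E0.
split=> //.
- by rewrite lamE /tau; field; rewrite D0 q0 K0.
- have -> : theta = ((1 + lambda) * B - k * D / q) / A by rewrite -denE; field.
  have -> : lambda * delta + ((1 + lambda) * B - k * D / q) / A =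
    B / A + (lambda * E - k * D / q) / A by rewrite /E; field; rewrite A0 q0.
  congr (_ + _); rewrite VE lamE /tau.
  have -> : (D / (A * k ^+ 2 - D ^+ 2) * (k * E / q + D) * E - k * D / q) / A =
    D * (k * E ^+ 2 + D * E * q - k * (A * k ^+ 2 - D ^+ 2)) / q /
      (A * k ^+ 2 - D ^+ 2) / A.
    by field; rewrite A0 q0 K0.
  by rewrite EE; field; rewrite A0 q0 K0 D0.
- rewrite VE.
  have -> : B / A + tau * (D ^+ 2 / A) + delta = (E + tau * D ^+ 2) / A.
    by rewrite /E; field.
  (* Times [A ^+ 2], the tightness condition is a quadratic equation in [tau], with leading
     coefficient [D ^+ 2 * (A * k ^+ 2 - D ^+ 2)]; [tau] is its root with the plus sign. *)
  apply/eqP; rewrite -subr_eq0; apply/eqP.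
  have -> : k ^+ 2 * (A^-1 + tau ^+ 2 * (D ^+ 2 / A)) -
     ((E + tau * D ^+ 2) / A) ^+ 2 =
     (A * k ^+ 2 - E ^+ 2 + tau * D ^+ 2 *
        (tau * (A * k ^+ 2 - D ^+ 2) - 2 * E)) / A ^+ 2.
    by field.
  rewrite /tau divfK//.
  have -> : (E + A * k * q / D) / (A * k ^+ 2 - D ^+ 2) * D ^+ 2 *
     (E + A * k * q / D - 2 * E) =
     (A ^+ 2 * k ^+ 2 * q ^+ 2 - D ^+ 2 * E ^+ 2) / (A * k ^+ 2 - D ^+ 2).
    by field; rewrite K0.
  by rewrite EE; field; rewrite A0 K0.
- rewrite VE.
  have -> : k ^+ 2 * tau - (B / A + tau * (D ^+ 2 / A) + delta) =
     (tau * (A * k ^+ 2 - D ^+ 2) - E) / A by rewrite /E; field.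
  by rewrite /tau divfK//; field; rewrite ?A0 ?D0.
Qed.

(** * Dot products and positive definite forms *)

Lemma dotmulC (R : realType) (n : nat) (u v : 'cV[R]_n) :
  dotmul u v = dotmul v u.
Proof. by rewrite /dotmul -[v in LHS]trmxK -trmx_mul mxE. Qed.

Lemma dotmulDr (R : realType) (n : nat) (u v w : 'cV[R]_n) :
  dotmul u (v + w) = dotmul u v + dotmul u w.
Proof. by rewrite /dotmul mulmxDr mxE. Qed.

Lemma dotmulNr (R : realType) (n : nat) (u v : 'cV[R]_n) :
  dotmul u (- v) = - dotmul u v.
Proof. by rewrite /dotmul mulmxN mxE. Qed.

Lemma dotmulZr (R : realType) (n : nat) (a : R) (u v : 'cV[R]_n) :
  dotmul u (a *: v) = a * dotmul u v.
Proof. by rewrite /dotmul -scalemxAr mxE. Qed.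

Lemma dotmul0r (R : realType) (n : nat) (u : 'cV[R]_n) : dotmul u 0 = 0.
Proof. by rewrite /dotmul mulmx0 mxE. Qed.

Lemma dotmul_mulmxr (R : realType) (n : nat) (M : 'M[R]_n) (u v : 'cV[R]_n) :
  dotmul u (M *m v) = dotmul (M^T *m u) v.
Proof. by rewrite /dotmul trmx_mul trmxK mulmxA. Qed.

Definition posdefmx (R : realType) (n : nat) (M : 'M[R]_n) : Prop :=
  M^T = M /\ forall x, x != 0 -> 0 < dotmul x (M *m x).

Lemma sym_formC (R : realType) (n : nat) (M : 'M[R]_n) (x y : 'cV[R]_n) :
  M^T = M -> dotmul x (M *m y) = dotmul y (M *m x).
Proof. by move=> MT; rewrite dotmul_mulmxr MT dotmulC. Qed.

Lemma sym_formB (R : realType) (n : nat) (M : 'M[R]_n) (x y : 'cV[R]_n) :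
  M^T = M ->
  dotmul (x - y) (M *m (x - y)) =
  dotmul x (M *m x) - 2 * dotmul x (M *m y) + dotmul y (M *m y).
Proof.
move=> MT; rewrite mulmxBr dotmulDr dotmulNr.
rewrite (dotmulC (x - y) (M *m x)) (dotmulC (x - y) (M *m y)).
rewrite !dotmulDr !dotmulNr !(dotmulC (M *m _)) (sym_formC y x MT); ring.
Qed.

(** If the form vanishes at [x], then along [y - t *: x] it is affine in [t], and nonnegativity
    forces its slope to be zero. Hence [M *m x] is orthogonal to every [y], and invertibility gives
    [x = 0]. *)
Lemma psd_unitmx_posdefmx (R : realType) (n : nat) (M : 'M[R]_n) :
  M^T = M -> (forall x, 0 <= dotmul x (M *m x)) -> M \in unitmx ->
  posdefmx M.
Proof.
move=> MT M_ge0 Mu; split=> // x x0; rewrite lt_neqAle M_ge0 andbT eq_sym.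
apply: contra_neq x0 => Qx0.
have form0 y : dotmul y (M *m x) = 0.
  apply/eqP/negP => /negP f0.
  (* The value of [t] is chosen so that the form [Q - 2 * t * f] equals [-1]. *)
  set f := dotmul y (M *m x) in f0; set Q := dotmul y (M *m y).
  have := M_ge0 (y - ((Q + 1) / (2 * f)) *: x).
  rewrite sym_formB// -!scalemxAr !dotmulZr (dotmulC (_ *: _)) dotmulZr.
  rewrite (dotmulC _ x) Qx0 !mulr0 addr0 -/f -/Q.
  have -> : Q - 2 * ((Q + 1) / (2 * f) * f) = - 1 by field.
  by rewrite oppr_ge0 ler10.
suff Mx0 : M *m x = 0 by rewrite -[x](mulKmx Mu) Mx0 mulmx0.
apply/colP => i; rewrite [RHS]mxE -(form0 (delta_mx i 0)) /dotmul trmx_delta.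
by rewrite -rowE [RHS]mxE.
Qed.

Lemma posdefmx_form_ge0 (R : realType) (n : nat) (M : 'M[R]_n) x :
  posdefmx M -> 0 <= dotmul x (M *m x).
Proof.
move=> [_ Mpos]; have [->|/Mpos/ltW//] := eqVneq x 0.
by rewrite mulmx0 dotmul0r.
Qed.

Lemma posdefmx_form_le0 (R : realType) (n : nat) (M : 'M[R]_n) x :
  posdefmx M -> dotmul x (M *m x) <= 0 -> x = 0.
Proof.
move=> [_ Mpos]; have [//|/Mpos] := eqVneq x 0.
by rewrite ltNge => /negbTE->.
Qed.

Lemma sqr_stdev (R : realType) (n : nat) (M : 'M[R]_n) x :
  posdefmx M -> stdev M x ^+ 2 = dotmul x (M *m x).
Proof. by move=> Mpos; rewrite sqr_sqrtr// posdefmx_form_ge0. Qed.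

Lemma stdev_ge0 (R : realType) (n : nat) (M : 'M[R]_n) x : 0 <= stdev M x.
Proof. exact: sqrtr_ge0. Qed.

(** Cauchy-Schwarz, from nonnegativity of the form at [x] minus its [M]-orthogonal projection onto
    [y]. *)
Lemma form_le_stdev (R : realType) (n : nat) (M : 'M[R]_n) x y :
  posdefmx M -> dotmul x (M *m y) <= stdev M x * stdev M y.
Proof.
move=> Mpos; have [MT _] := Mpos.
have [->|y0] := eqVneq y 0.
  by rewrite mulmx0 dotmul0r mulr_ge0 ?stdev_ge0.
have Qy : 0 < dotmul y (M *m y) by have [_] := Mpos; exact.
apply: le_trans (ler_norm _) _; rewrite -ler_sqr ?nnegrE ?mulr_ge0 ?stdev_ge0//.
rewrite real_normK ?num_real// exprMn !sqr_stdev//.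
set f := dotmul x (M *m y); set Q := dotmul y (M *m y) in Qy *.
have := posdefmx_form_ge0 (x - (f / Q) *: y) Mpos.
rewrite sym_formB// -!scalemxAr !dotmulZr (dotmulC (_ *: _)) dotmulZr.
rewrite (dotmulC _ y) -/f -/Q; set P := dotmul x _.
have -> : P - 2 * (f / Q * f) + f / Q * (f / Q * Q) = (P * Q - f ^+ 2) / Q.
  by field; rewrite gt_eqF.
by rewrite pmulr_lge0 ?invr_gt0// subr_ge0.
Qed.

Lemma posdefmx_inv (R : realType) (n : nat) (M : 'M[R]_n) :
  M \in unitmx -> posdefmx M -> posdefmx (invmx M).
Proof.
move=> Mu [MT Mpos]; split; first by rewrite trmx_inv MT.
move=> x x0; rewrite dotmulC -[X in dotmul _ X](mulKVmx Mu) Mpos//.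
by apply: contra_neq x0 => Mx0; rewrite -[x](mulKVmx Mu) Mx0 mulmx0.
Qed.

(* As [tau] varies, these portfolios are the minimum-variance portfolios of
   given mean, [tau = 0] giving the global minimum-variance portfolio. *)
Definition frontier {R : realType} {n : nat} (mu : 'cV[R]_n) (Sigma : 'M[R]_n)
    (tau : R) : 'cV[R]_n :=
  let A := dotmul ones (invmx Sigma *m ones) in
  let B := dotmul mu (invmx Sigma *m ones) in
  invmx Sigma *m (A^-1 *: ones + tau *: (mu - (B / A) *: ones)).

(** * The mean-deviation frontier and the two optimization problems *)

Section Frontier.
Context {R : realType} {n : nat} (mu : 'cV[R]_n) (Sigma : 'M[R]_n).
Hypotheses (Sigma_unit : Sigma \in unitmx) (Sigma_pos : posdefmx Sigma).
Let A := dotmul ones (invmx Sigma *m ones).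
Let B := dotmul mu (invmx Sigma *m ones).
Let C := dotmul mu (invmx Sigma *m mu).
Let V := C - B ^+ 2 / A.
Hypothesis A_neq0 : A != 0.

Let inv_pos : posdefmx (invmx Sigma).
Proof. exact: posdefmx_inv. Qed.

Lemma inv_form_ones_gt0 : 0 < A.
Proof. by rewrite lt_neqAle eq_sym A_neq0 posdefmx_form_ge0. Qed.

Let B_sym : dotmul ones (invmx Sigma *m mu) = B.
Proof. by rewrite sym_formC// (proj1 inv_pos). Qed.

(** In the inner product of [invmx Sigma], [V] is the squared length of the component of [mu]
    orthogonal to [ones]; its sign and its vanishing are read off from this. *)
Lemma form_excess_mean :
  dotmul (mu - (B / A) *: ones) (invmx Sigma *m (mu - (B / A) *: ones)) = V.
Proof.
rewrite sym_formB ?(proj1 inv_pos)// -!scalemxAr !dotmulZr -/B -/C.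
rewrite (dotmulC (_ *: _)) dotmulZr (dotmulC _ ones) -/A /V.
by field.
Qed.

Lemma frontier_curvature_ge0 : 0 <= V.
Proof. by rewrite -form_excess_mean posdefmx_form_ge0. Qed.

Lemma frontier_curvature_eq0 : V = 0 -> mu = (B / A) *: ones.
Proof.
move=> V0; apply/eqP; rewrite -subr_eq0; apply/eqP.
by apply: (posdefmx_form_le0 inv_pos); rewrite form_excess_mean V0.
Qed.

Lemma frontier_curvature_prop c : mu = c *: ones -> V = 0.
Proof.
move=> muE.
have BE : B = c * A by rewrite /B muE dotmulC dotmulZr dotmulC.
have CE : C = c * B by rewrite /C {1}muE dotmulC dotmulZr dotmulC B_sym.
by rewrite /V CE BE; field.
Qed.

Lemma form_frontier x tau : budget x ->
  dotmul x (Sigma *m frontier mu Sigma tau) =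
  A^-1 + tau * (dotmul x mu - B / A).
Proof.
move=> xe; rewrite /frontier -/A -/B mulKVmx//.
by rewrite !(dotmulDr, dotmulZr, dotmulNr) xe !mulr1.
Qed.

Lemma frontier_budget tau : budget (frontier mu Sigma tau).
Proof.
rewrite /budget /= /frontier -/A -/B dotmulC mulmxDr -!scalemxAr mulmxBr.
rewrite -scalemxAr !(dotmulDr, dotmulZr, dotmulNr) B_sym -/A.
by field.
Qed.

Lemma frontier_mean tau :
  dotmul (frontier mu Sigma tau) mu = B / A + tau * V.
Proof.
rewrite /frontier -/A -/B dotmulC mulmxDr -!scalemxAr mulmxBr.
rewrite -scalemxAr !(dotmulDr, dotmulZr, dotmulNr) -/B -/C /V.
by field.
Qed.

Lemma frontier_variance tau :
  stdev Sigma (frontier mu Sigma tau) ^+ 2 = A^-1 + tau ^+ 2 * V.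
Proof.
rewrite sqr_stdev// form_frontier ?frontier_mean; last exact: frontier_budget.
by rewrite addrAC subrr add0r mulrA.
Qed.

(** With equal means, the cross term of the form at the difference of the two portfolios equals the
    frontier variance, so the form is the difference of the variances, here at most zero. *)
Lemma frontier_unique x tau : budget x ->
  dotmul x mu = dotmul (frontier mu Sigma tau) mu ->
  stdev Sigma x <= stdev Sigma (frontier mu Sigma tau) ->
  x = frontier mu Sigma tau.
Proof.
move=> xe xmu; rewrite -ler_sqr ?nnegrE ?stdev_ge0// => sx.
apply/eqP; rewrite -subr_eq0; apply/eqP.
apply: (posdefmx_form_le0 Sigma_pos); rewrite sym_formB ?(proj1 Sigma_pos)//.
rewrite form_frontier// -!sqr_stdev// xmu frontier_mean.
move: sx; rewrite frontier_variance; lra.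
Qed.

Lemma frontier_stdev_le x tau : budget x ->
  A^-1 + tau * (dotmul x mu - B / A) <=
  stdev Sigma x * stdev Sigma (frontier mu Sigma tau).
Proof. by move=> xe; rewrite -form_frontier// form_le_stdev. Qed.

(** For a feasible mean [m], the supporting line times [k ^+ 2], combined with the risk constraint
    and tightness, reads [(k ^+ 2 * tau - p) * (m - (B / A + tau * V)) <= 0]; a positive first
    factor bounds [m]. *)
Lemma frontier_cco_optimal (k delta tau : R) :
  let p := B / A + tau * V + delta in
  0 < k -> 0 < p -> k ^+ 2 * (A^-1 + tau ^+ 2 * V) = p ^+ 2 ->
  0 < k ^+ 2 * tau - p ->
  optimal (cco_feasible mu Sigma k delta) (fun x => dotmul x mu)
    (frontier mu Sigma tau) /\
  forall x, optimal (cco_feasible mu Sigma k delta) (fun x => dotmul x mu) x ->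
    x = frontier mu Sigma tau.
Proof.
move=> p k_gt0 p_gt0 pE slope.
have ks : k * stdev Sigma (frontier mu Sigma tau) = p.
  apply/eqP; rewrite -(@eqrXn2 _ 2)// ?mulr_ge0 ?stdev_ge0 1?ltW//.
  by rewrite exprMn frontier_variance pE.
have opt : optimal (cco_feasible mu Sigma k delta) (fun x => dotmul x mu)
    (frontier mu Sigma tau).
  split=> [|x [xe xf]].
    split; first exact: frontier_budget.
    by rewrite ks frontier_mean /p addrAC subrr add0r.
  rewrite frontier_mean; set m := dotmul x mu in xf *.
  have := frontier_stdev_le tau xe; rewrite -/m => sx.
  have : k ^+ 2 * (A^-1 + tau * (m - B / A)) <= (m + delta) * p.
    apply: (le_trans (ler_wpM2l _ sx)); first by rewrite sqr_ge0.
    by rewrite expr2 mulrACA ks ler_wpM2r ?(ltW p_gt0)//; lra.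
  have -> : k ^+ 2 * (A^-1 + tau * (m - B / A)) =
    p ^+ 2 + k ^+ 2 * tau * (m - (B / A + tau * V)) by rewrite -pE; ring.
  have -> : (m + delta) * p = p ^+ 2 + p * (m - (B / A + tau * V)).
    by rewrite /p; ring.
  by rewrite lerD2l -subr_le0 -mulrBl pmulr_rle0// subr_le0.
split=> // x [[xe xf] xopt].
have xmu : dotmul x mu = dotmul (frontier mu Sigma tau) mu.
  by apply/eqP; rewrite eq_le opt.2//= xopt//; case: opt.
apply: frontier_unique => //; rewrite -(ler_pM2l k_gt0) ks.
by rewrite xmu frontier_mean in xf; rewrite /p; lra.
Qed.

Lemma frontier_dro_optimal (rho phi2 : R) :
  0 < phi2 -> phi2 / 2 * V < rho ->
  optimal budget (dro_objective mu Sigma rho phi2)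
    (frontier mu Sigma (Num.sqrt (A * (2 * rho / phi2 - V)))^-1) /\
  dro_objective mu Sigma rho phi2
    (frontier mu Sigma (Num.sqrt (A * (2 * rho / phi2 - V)))^-1) <= B / A.
Proof.
move=> phi2_gt0 rho_gt.
set h := Num.sqrt _.
have kV : V < 2 * rho / phi2 by rewrite ltr_pdivlMr//; lra.
have k2_ge0 : 0 <= 2 * rho / phi2.
  exact: le_trans frontier_curvature_ge0 (ltW kV).
set k := Num.sqrt (2 * rho / phi2).
have k_ge0 : 0 <= k by exact: sqrtr_ge0.
have kk : k ^+ 2 = 2 * rho / phi2 by rewrite sqr_sqrtr.
have h_gt0 : 0 < h.
  by rewrite sqrtr_gt0 mulr_gt0 ?inv_form_ones_gt0// subr_gt0.
have hh : h ^+ 2 = A * (k ^+ 2 - V).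
  by rewrite kk sqr_sqrtr// mulr_ge0 ?ltW ?inv_form_ones_gt0// subr_gt0.
have gE x : dro_objective mu Sigma rho phi2 x =
    dotmul x mu - k * stdev Sigma x.
  by rewrite /dro_objective mulrAC sqrtrM.
have sE : stdev Sigma (frontier mu Sigma h^-1) = k / h.
  apply/eqP; rewrite -(@eqrXn2 _ 2)// ?divr_ge0 ?stdev_ge0 ?(ltW h_gt0)//.
  rewrite frontier_variance exprVn expr_div_n.
  have -> : k ^+ 2 = h ^+ 2 / A + V by rewrite hh; field.
  by apply/eqP; field; rewrite A_neq0 gt_eqF.
have vE : dro_objective mu Sigma rho phi2 (frontier mu Sigma h^-1) =
    B / A - h / A.
  rewrite gE sE frontier_mean.
  have -> : V = k ^+ 2 - h ^+ 2 / A by rewrite hh; field.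
  by field; rewrite A_neq0 gt_eqF.
have h_ge0 := ltW h_gt0; have A_ge0 := ltW inv_form_ones_gt0.
split; last by rewrite vE gerBl divr_ge0.
split=> [|x xe]; first exact: frontier_budget.
(* The supporting line at [h^-1], multiplied by [h], says that [h / A + (dotmul x mu - B / A)] is at
   most [k * stdev Sigma x]. *)
rewrite vE gE; have := frontier_stdev_le h^-1 xe.
rewrite sE -(ler_pM2l h_gt0).
have -> : h * (stdev Sigma x * (k / h)) = k * stdev Sigma x.
  by field; rewrite gt_eqF.
rewrite mulrDr mulrA mulfV ?gt_eqF// mul1r; lra.
Qed.

End Frontier.

(** * Optimal values and assembly of the theorem *)

Lemma optimal_valueE (R : realType) (T : Type) (X : set T) (f : T -> R) x :
  optimal X f x -> optimal_value X f = f x.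
Proof.
move=> [Xx fx]; apply/eqP; rewrite eq_le; apply/andP; split.
  by apply: ge_sup; [exists (f x), x | move=> _ [y Xy <-]; exact: fx].
apply: ub_le_sup; last by exists x.
by exists (f x) => _ [y Xy <-]; exact: fx.
Qed.

Theorem theorem4p2 (R : realType) (d : measure_display) (T : measurableType d)
    (P0 : probability T R) (n : nat) (r : 'I_n -> {RV P0 >-> R})
    (mu : 'cV[R]_n) (Sigma : 'M[R]_n) (kappa : R -> R) (epsilon delta : R)
    (r_L2 : forall i, (r i : T -> R) \in Lfun P0 2%:E)
    (mu_def : mu = mean_vector r)
    (Sigma_def : Sigma = covariance_matrix r)
    (Sigma_unit : Sigma \in unitmx)
    (epsilon_gt0 : 0 < epsilon) (delta_gt0 : 0 < delta)
    (kappa_gt0 : 0 < kappa epsilon) :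
  let k := kappa epsilon in
  let A := dotmul ones (invmx Sigma *m ones) in
  let B := dotmul mu (invmx Sigma *m ones) in
  let C := dotmul mu (invmx Sigma *m mu) in
  C - B ^+ 2 / A < k ^+ 2 ->
  k ^+ 2 < delta ^+ 2 * A + 2 * delta * B + C ->
  0 < B + delta * A ->
  let lambda :=
    Num.sqrt (A * C - B ^+ 2) / (A * k ^+ 2 - A * C + B ^+ 2)
    * (k * (B + A * delta)
         / Num.sqrt (A * delta ^+ 2 + 2 * B * delta + C - k ^+ 2)
       + Num.sqrt (A * C - B ^+ 2)) in
  let theta :=
    ((C + delta * B) * (lambda + 1) - lambda * k ^+ 2) / (B + delta * A) in
  let x_star :=
    ((1 + lambda) * B - theta * A)^-1
    *: (invmx Sigma *m ((1 + lambda) *: mu - theta *: ones)) in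
  let F := cco_feasible mu Sigma k delta in
  let v_cco := optimal_value F (fun x => dotmul x mu) in
  [/\ exists x, optimal F (fun x => dotmul x mu) x,
      (* if mu is proportional to e then x_star reads 0/0 (and the optimal
         solution need not be unique) *)
      ~ (exists c, mu = c *: ones) ->
        forall x, optimal F (fun x => dotmul x mu) x <-> x = x_star,
      v_cco = lambda * delta + theta
    & forall (phi : R -> R) (rho : R),
        twice_derivable phi 1 -> 0 < (phi^`(2))%classic 1 ->
        0 < rho -> (phi^`(2))%classic 1 / 2 * (C - B ^+ 2 / A) < rho ->
        let g := dro_objective mu Sigma rho ((phi^`(2))%classic 1) in
        (exists x, optimal budget g x) /\ optimal_value budget g <= v_cco].

Proof.
move=> k A B C kV kq E_gt0 lambda theta x_star F v_cco.
have k_gt0 : 0 < k by [].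
have Sigma_pos : posdefmx Sigma.
  apply: psd_unitmx_posdefmx => //.
    by rewrite Sigma_def tr_covariance_matrix.
  move=> x; rewrite Sigma_def covariance_matrix_form//.
  by rewrite fine_ge0// variance_ge0.
have A_neq0 : A != 0.
  (* If [A = 0] then [ones = 0], so [B] vanishes too, against [0 < B + delta * A]. *)
  apply: contraTneq E_gt0 => A0.
  have e0 : (ones : 'cV[R]_n) = 0.
    apply: (posdefmx_form_le0 (posdefmx_inv Sigma_unit Sigma_pos)).
    by rewrite -/A A0.
  by rewrite A0 mulr0 addr0 /B e0 mulmx0 dotmul0r ltxx.
have A_gt0 := inv_form_ones_gt0 Sigma_unit Sigma_pos A_neq0.
have V_ge0 := frontier_curvature_ge0 mu Sigma_unit Sigma_pos A_neq0.
rewrite -/A -/B -/C in A_gt0 V_ge0.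
set E := B + delta * A in E_gt0.
set V := C - B ^+ 2 / A in V_ge0 kV.
have ACB : A * C - B ^+ 2 = A * V by rewrite /V; field.
set D := Num.sqrt (A * C - B ^+ 2).
have D_ge0 : 0 <= D by exact: sqrtr_ge0.
have DD : D ^+ 2 = A * C - B ^+ 2.
  by rewrite sqr_sqrtr// ACB mulr_ge0 ?(ltW A_gt0).
set q := Num.sqrt (A * delta ^+ 2 + 2 * B * delta + C - k ^+ 2).
have q_arg_gt0 : 0 < A * delta ^+ 2 + 2 * B * delta + C - k ^+ 2 by lra.
have q_gt0 : 0 < q by rewrite sqrtr_gt0.
have qq : q ^+ 2 = A * delta ^+ 2 + 2 * B * delta + C - k ^+ 2.
  by rewrite sqr_sqrtr// ltW.
have K_gt0 : 0 < A * k ^+ 2 - D ^+ 2.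
  by rewrite DD ACB -mulrBr mulr_gt0// subr_gt0.
(* The two values are compared through [B / A], which bounds the (DRO) value from above. *)
suff [z [zopt zunique zval BAz]] : exists z,
    [/\ optimal F (fun x => dotmul x mu) z,
      ~ (exists c, mu = c *: ones) ->
        forall x, optimal F (fun x => dotmul x mu) x <-> x = x_star,
      dotmul z mu = lambda * delta + theta & B / A <= dotmul z mu].
  have vE : v_cco = dotmul z mu by exact: optimal_valueE zopt.
  split=> //; [by exists z | by rewrite vE|].
  move=> phi rho _ phi2_gt0 _ rho_gt g.
  have [gopt gle] := frontier_dro_optimal Sigma_unit Sigma_pos A_neq0
    phi2_gt0 rho_gt.
  split; first by eexists; exact: gopt.
  by rewrite (optimal_valueE gopt) vE (le_trans gle).
have [V0|V_neq0] := eqVneq V 0.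
  have muE := frontier_curvature_eq0 Sigma_unit Sigma_pos A_neq0 V0.
  rewrite -/A -/B in muE.
  have D0 : D = 0 by rewrite /D ACB V0 mulr0 sqrtr0.
  have C_E : C = B ^+ 2 / A by apply/eqP; rewrite -subr_eq0 -/V V0.
  have mean x : budget x -> dotmul x mu = B / A.
    by move=> xe; rewrite muE dotmulZr xe mulr1.
  (* All means agree, so any feasible portfolio is optimal. The global minimum-variance one is
     feasible because, with [C = B ^+ 2 / A], the upper bound on [k ^+ 2] becomes
     [k ^+ 2 / A < (delta + B / A) ^+ 2]. *)
  have z_budget := frontier_budget mu Sigma_unit Sigma_pos A_neq0 0.
  exists (frontier mu Sigma 0); split.
  - split=> [|x [xe _]]; last by rewrite !mean.
    split=> //=; rewrite mean// lerBlDr -ler_sqr ?nnegrE; last 2 first.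
    + by rewrite mulr_ge0 ?(ltW k_gt0) ?stdev_ge0.
    + have -> : delta + B / A = E / A by rewrite /E; field.
      by rewrite divr_ge0 ?ltW.
    rewrite exprMn frontier_variance// -/A expr0n mul0r addr0 ler_pdivrMr//.
    have -> : (delta + B / A) ^+ 2 * A = delta ^+ 2 * A + 2 * delta * B + C.
      by rewrite C_E; field.
    exact: ltW.
  - by case; exists (B / A).
  (* Here [lambda = 0], and [theta] collapses to [B / A]. *)
  - rewrite mean// /theta /lambda -/D D0 !mul0r !add0r mulr1 subr0 -/E C_E.
    by move: (gt_eqF E_gt0); rewrite /E => E0; field; rewrite A_neq0 E0.
  - by rewrite mean.
have V_gt0 : 0 < V by rewrite lt_neqAle eq_sym V_neq0.
have D_gt0 : 0 < D by rewrite sqrtr_gt0 ACB mulr_gt0.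
have [denE lamE valE stdE slopeE] := frontier_scalars DD qq A_neq0
  (lt0r_neq0 E_gt0) (lt0r_neq0 q_gt0) (lt0r_neq0 D_gt0)
  (lt0r_neq0 K_gt0).
rewrite -/lambda -/E -/theta -/V in denE lamE valE stdE slopeE.
set tau := (E + A * k * q / D) / _ in lamE valE stdE slopeE.
have tau_gt0 : 0 < tau by rewrite divr_gt0// addr_gt0// ?divr_gt0 ?mulr_gt0.
clearbody tau.
have p_gt0 : 0 < B / A + tau * V + delta.
  have -> : B / A + tau * V + delta = E / A + tau * V by rewrite /E; field.
  by rewrite addr_gt0 ?divr_gt0 ?mulr_gt0.
have slope_gt0 : 0 < k ^+ 2 * tau - (B / A + tau * V + delta).
  by rewrite slopeE divr_gt0 ?mulr_gt0.
have [opt uniq] := frontier_cco_optimal Sigma_unit Sigma_pos A_neq0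
  k_gt0 p_gt0 stdE slope_gt0.
have mean : dotmul (frontier mu Sigma tau) mu = B / A + tau * V.
  exact: frontier_mean.
(* Both [1 + lambda] and [theta] carry the factor [k * D / q], which is also the normalizing
   denominator of [x_star] and cancels. *)
have x_starE : x_star = frontier mu Sigma tau.
  have den_neq0 : k * D / q != 0 by rewrite gt_eqF ?divr_gt0 ?mulr_gt0.
  rewrite /x_star denE scalemxAr /frontier -/A -/B; congr (_ *m _).
  have thetaE : theta = (tau * (k * D / q) * B - k * D / q) / A.
    by rewrite -lamE -denE; field.
  rewrite lamE thetaE; apply/colP => i; rewrite !mxE.
  by move: (k * D / q) den_neq0 => c c0; field; rewrite A_neq0 c0.
exists (frontier mu Sigma tau); split=> //.
- by move=> _ x; rewrite x_starE; split=> [/uniq//|->].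
- by rewrite mean.
- by rewrite mean lerDl mulr_ge0 ?ltW.
Qed.
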